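(* Let $f \in \mathbb{Z}[x]$ be a monic polynomial of degree at least $2$. Let $P \in \mathbb{Z}[x_1,\dots,x_n]$ be a primitive polynomial. Suppose that, in the ring $\mathbb{C}[x_1,\dots,x_n]$, $P$ divides some polynomial $Q \in \mathbb{C}[x_1,\dots,x_n]$ that is a product of factors of the form $$\tilde f^{\,a}(x_i) - L(\tilde f^{\,b}(x_j)),$$ where $a, b \ge 0$ are integers, $i,j\in\{1,\dots,n\}$ (possibly $i=j$), $L \in \mathbb{C}[x]$ is a linear polynomial commuting with an iterate of $f$, and $\tilde f \in \mathbb{C}[x]$ is a non-linear polynomial of minimal degree commuting with an iterate of $f$ (with possibly different choices of $L$, $\tilde f$, $a$, $b$, $i$, $j$ for each factor). Then, in the ring $\mathbb{Z}[x_1,\dots,x_n]$, $P$ divides some polynomial $R \in \mathbb{Z}[x_1,\dots,x_n]$ that is a product of factors of the form $\tilde f^{\,a}(x_i) - L(\tilde f^{\,b}(x_j))$ with $a,b,i,j,\tilde f, L$ of the same kind (again possibly different for each factor; the individual factors need not have integer coefficients).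
   Context: For a polynomial $g$, $g^{k}$ denotes the $k$-fold composition $g\circ\cdots\circ g$ (with $g^0$ the identity). Two polynomials $g,h$ commute if $g\circ h = h\circ g$. An iterate of $f$ is $f^k$ with $k\ge 1$. A polynomial in $\mathbb{Z}[x_1,\dots,x_n]$ is primitive if the gcd of its coefficients is $1$. ''Linear'' means of degree $1$; ''non-linear'' means of degree at least $2$. ''Non-linear polynomial of minimal degree commuting with an iterate of $f$'' means: $\tilde f$ has degree at least $2$, $\tilde f$ commutes with some iterate of $f$, and its degree is minimal among all polynomials in $\mathbb{C}[x]$ of degree at least $2$ that commute with some iterate of $f$. *)

(* Defs.v *)
From HB Require Import structures.
From mathcomp Require Import all_boot all_order all_algebra.
From mathcomp Require Import reals complex mpoly.

Set Implicit Arguments.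
Unset Strict Implicit.
Unset Printing Implicit Defensive.

Import GRing.Theory.

Local Open Scope ring_scope.

Definition iter_poly (K : nzRingType) (g : {poly K}) (k : nat) : {poly K} :=
  iter k (fun h => g \Po h) 'X.

Definition commutes_with_iterate (K : nzRingType) (f g : {poly K}) : Prop :=
  exists2 k : nat, (0 < k)%N & g \Po iter_poly f k = iter_poly f k \Po g.

Definition nonlinear (K : nzRingType) (g : {poly K}) : Prop := (2 < size g)%N.

Definition linear_poly (K : nzRingType) (g : {poly K}) : Prop := size g = 2%N.

Definition minimal_commuting (K : nzRingType) (f g : {poly K}) : Prop :=
  [/\ nonlinear g, commutes_with_iterate f g
    & forall h : {poly K}, nonlinear h -> commutes_with_iterate f h ->
        (size g <= size h)%N].

(* [horner_alg 'X_i p] is the univariate polynomial p evaluated at x_i.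
   Nothing excludes a factor that is identically 0, such as x_i - x_i; a claim
   that some special product exists must therefore also say that it is nonzero. *)
Definition special_factor (K : comNzRingType) (f : {poly K}) (n : nat)
    (F : {mpoly K[n]}) : Prop :=
  exists (g L : {poly K}) (a b : nat) (i j : 'I_n),
    [/\ minimal_commuting f g, linear_poly L, commutes_with_iterate f L
      & F = horner_alg 'X_i (iter_poly g a)
            - horner_alg 'X_j (L \Po iter_poly g b)].

Definition special_product (K : comNzRingType) (f : {poly K}) (n : nat)
    (Q : {mpoly K[n]}) : Prop :=
  exists2 s : seq {mpoly K[n]},
    forall F, F \in s -> special_factor f F & Q = \prod_(F <- s) F.

Definition mdivides (K : comNzRingType) (n : nat) (P Q : {mpoly K[n]}) : Prop :=
  exists S : {mpoly K[n]}, Q = S * P.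

Definition mprimitive (n : nat) (P : {mpoly int[n]}) : Prop :=
  \big[gcdz/0]_(m <- msupp P) P@_m = 1.

(* Main.v *)
Require Import Defs.
From HB Require Import structures.
From mathcomp Require Import all_boot all_order all_fingroup all_algebra all_field.
From mathcomp Require Import boolp reals complex mpoly.

Set Implicit Arguments.
Unset Strict Implicit.
Unset Printing Implicit Defensive.

Import Order.Theory GRing.Theory Num.Theory.

Local Open Scope ring_scope.

(** Why the theorem is true.  A polynomial [g] of positive degree commuting with
    a monic integral polynomial [F] of degree at least 2 has algebraic integers
    as coefficients ([algint_commuting]).  Its leading coefficient is a root of
    unity, and if [b] is a fixed point of [F] then [F] maps the finite fibre
    [g^-1(b)] to itself; hence every point of this fibre has a finite orbit under
    [F], which makes it a root of a difference of two iterates of [F], a monic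
    integral polynomial.

    So every special factor has coefficients in a number field, and a Galois
    automorphism of that field sends special factors to special factors
    ([special_factor_conj]): it fixes the coefficients of [f], hence preserves
    commutation with its iterates, and it preserves degrees, hence minimality.
    Let [N] be the product of the Galois conjugates of [Q].  It is a special
    product; its coefficients are fixed by the Galois group and are algebraic
    integers, so they are integers; it is a multiple of [Q], hence of [P]; and it
    is nonzero if [Q] is.  It remains to bring the division of [N] by [P] down to
    the integers ([mprimitive_dvd]): the quotient is rational because leading
    monomials can be divided one after the other, and integral by Gauss's lemma.

    If [Q = 0], then 0 is itself a special product, and it is a multiple of
    [P]. *)

(** * Number fields inside an algebraically closed field *)

Section NumberField.

Variable L : numClosedFieldType.
Implicit Types (t : seq L) (x z : L).

Local Notation ratL := (map_poly (ratr : rat -> L)).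

Lemma integral_root_ratr x :
  integralOver (intr : int -> L) x ->
  exists2 q : {poly rat}, q != 0 & root (ratL q) x.
Proof.
case=> q q_mon qx0; exists (map_poly intr q).
  by rewrite monic_neq0 // monic_map.
by rewrite -map_poly_comp (eq_map_poly (fun c => ratr_int L c)).
Qed.

(** Folding the two-element primitive element theorem over [t].  The generator
    is kept as an integral combination of [t], so that the field it generates is
    generated by [t]: this is what makes that field a splitting field below. *)
Lemma primitive_element t :
  {in t, forall x, exists2 q : {poly rat}, q != 0 & root (ratL q) x} ->
  exists z, [/\ exists2 q : {poly rat}, q != 0 & root (ratL q) z,
    exists a : nat -> int, z = \sum_(i < size t) t`_i *~ a i
    & {in t, forall x, exists q : {poly rat}, (ratL q).[z] = x}].
Proof.
elim: t => [_|y t IHt alg_yt].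
  exists 0; split=> //; last by exists (fun=> 0); rewrite big_ord0.
  by exists 'X; rewrite ?polyX_eq0 // map_polyX rootX.
have [|x [[p p_neq0 px0] [a x_comb] t_in]] := IHt.
  by move=> u u_t; apply: alg_yt; rewrite inE u_t orbT.
have [q q_neq0 qy0] := alg_yt y (mem_head _ _).
have [n [[px Dpx] [py Dpy]]] :=
  pchar0_PET p_neq0 px0 q_neq0 qy0 (pchar_num rat).
set z := y *+ n - x in Dpx Dpy; exists z; split.
- have /integral_algebraic[r r_neq0 rz0] : integralOver (ratr : rat -> L) z.
    apply: integral_sub; last by apply/integral_algebraic; exists p.
    rewrite -mulr_natr; apply: integral_mul; last exact: integral_nat.
    by apply/integral_algebraic; exists q.
  by exists r.
- exists (fun i => if i is i'.+1 then - a i' else n%:Z).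
  rewrite /= big_ord_recl /= /z x_comb -sumrN; congr (_ + _).
  by apply: eq_bigr => i _; rewrite mulrNz.
move=> u; rewrite inE => /predU1P[->|/t_in[r <-]]; first by exists py.
by exists (r \Po px); rewrite map_comp_poly horner_comp Dpx.
Qed.

Lemma lift_seq (K : fieldType) (phi : K -> L) t :
  {in t, forall x, exists y, phi y = x} -> exists t1 : seq K, map phi t1 = t.
Proof.
elim: t => [|x t IHt] lift_t; first by exists [::].
have [y <-] := lift_t x (mem_head _ _).
have [|t1 <-] := IHt.
  by move=> u u_t; apply: lift_t; rewrite inE u_t orbT.
by exists (y :: t1).
Qed.

(** The number field is built abstractly, as the quotient of the rational
    polynomials by the minimal polynomial of a primitive element of [t], and
    comes with its embedding; being generated by all the roots of [p], it is
    a splitting field. *)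
Lemma splitting_field_embedding (p : {poly rat}) t :
  p != 0 -> ratL p = lead_coef (ratL p) *: \prod_(x <- t) ('X - x%:P) ->
  exists (K : splittingFieldType rat) (iota : {rmorphism K -> L}),
    {in t, forall x, exists y, iota y = x}.
Proof.
move=> p_neq0 p_split.
have lp_neq0: lead_coef (ratL p) != 0 by rewrite lead_coef_eq0 map_poly_eq0.
have t_root: {in t, forall x, root (ratL p) x}.
  by move=> x x_t; rewrite p_split rootZ // root_prod_XsubC.
have [|z [alg_z [a z_comb] t_in]] := @primitive_element t.
  by move=> x /t_root px0; exists p.
have [r r_neq0 [rz0 r_irr]]: exists2 r : {poly rat}, r != 0
    & root (ratL r) z /\ irreducible_poly r.
  pose P n := `[< exists2 q : {poly rat}, q != 0
                  & root (ratL q) z /\ size q = n >].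
  have exP: exists n, P n.
    by have [q q_neq0 qz0] := alg_z; exists (size q); apply/asboolP; exists q.
  case: (ex_minnP exP) => n /asboolP[r r_neq0 [rz0 r_sz]] n_min.
  exists r => //; split=> //.
  apply/(subfx_irreducibleP (iota := ratr) rz0 r_neq0) => q qz0 q_neq0.
  by rewrite r_sz n_min //; apply/asboolP; exists q.
pose K := SubFieldExtType rz0 r_irr.
pose iota : {rmorphism K -> L} := @subfx_inj _ _ (ratr : rat -> L) z r.
pose z1 : K := subfx_root (ratr : rat -> L) z r.
have iota_z1 : iota z1 = z by apply: subfx_inj_root.
have iota_horner (q : {poly rat}) :
    iota (map_poly (in_alg K) q).[z1] = (ratL q).[z].
  rewrite -horner_map iota_z1 -map_poly_comp; congr _.[z].
  by apply: eq_map_poly => c; apply: subfx_inj_base.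
have [|t1 Dt] := @lift_seq K iota t.
  by move=> x /t_in[q <-]; exists (map_poly (in_alg K) q).[z1].
have t1_gen: <<1 & t1>>%VS = fullv.
  apply/vspaceP=> x; rewrite memvf.
  have [q ->] := subfxEroot rz0 r_neq0 x.
  apply: rpred_horner.
    apply/polyOverP=> i; rewrite coef_map /=.
    by apply: (subvP (subv_adjoin_seq _ _)); rewrite memvZ ?mem1v.
  have ->: subfx_root (ratr : rat -> L) z r = \sum_(i < size t1) t1`_i *~ a i.
    apply: (fmorph_inj iota); rewrite iota_z1 z_comb -Dt size_map rmorph_sum.
    by apply: eq_bigr => i _; rewrite rmorphMz (nth_map 0).
  apply: rpred_sum => i _; apply: rpredMz.
  by rewrite seqv_sub_adjoin ?mem_nth.
have K_split : splitting_field_axiom K.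
  exists (map_poly (in_alg K) p).
    by apply/polyOverP=> i; rewrite coef_map rpredZ ?mem1v.
  exists t1 => //; rewrite -(eqp_map iota) -map_poly_comp.
  rewrite (eq_map_poly (g := ratr)) => [|c]; last exact: subfx_inj_base.
  rewrite p_split rmorph_prod -Dt big_map.
  under [X in _ %= X]eq_bigr do rewrite /= map_polyXsubC.
  by rewrite eqp_scale.
pose KS : splittingFieldType rat :=
  HB.pack K (FieldExt_isSplittingField.Build rat K K_split).
by exists KS, iota => x; rewrite -Dt => /mapP[y _ ->]; exists y.
Qed.

(** Adjoining all the roots of monic integral equations satisfied by the
    elements of [t] gives a normal number field that contains [t]. *)
Lemma Galois_number_field t :
  {in t, forall x, integralOver (intr : int -> L) x} ->
  exists (K : splittingFieldType rat) (iota : {rmorphism K -> L}),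
    {in t, forall x, exists y, iota y = x}.
Proof.
move=> int_t.
have [p p_neq0 t_root]: exists2 p : {poly rat}, p != 0
    & {in t, forall x, root (ratL p) x}.
  elim: t int_t => [|x t IHt] int_xt; first by exists 1; rewrite ?oner_neq0.
  have [|p p_neq0 t_root] := IHt.
    by move=> y y_t; apply: int_xt; rewrite inE y_t orbT.
  have [q q_neq0 qx0] := integral_root_ratr (int_xt x (mem_head _ _)).
  exists (q * p) => [|y]; first by rewrite mulf_neq0.
  by rewrite rmorphM rootM inE => /predU1P[->|/t_root->]; rewrite ?qx0 ?orbT.
have [rs p_split] := closed_field_poly_normal (ratL p).
have [K [iota iota_rs]] := splitting_field_embedding p_neq0 p_split.
exists K, iota => x /t_root; rewrite p_split rootZ ?root_prod_XsubC.
  exact: iota_rs.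
by rewrite lead_coef_eq0 map_poly_eq0.
Qed.

End NumberField.

(** * Algebraic integers *)

(** Boolean, so that the closure properties of polynomials over a subring
    apply to it. *)
Definition algint {L : comNzRingType} : {pred L} :=
  fun x => `[< integralOver (intr : int -> L) x >].

Section AlgInt.

Variable L : comNzRingType.
Implicit Types x : L.

Lemma algintP x : reflect (integralOver (intr : int -> L) x) (x \in algint).
Proof. exact: asboolP. Qed.

Lemma algint_subring : subring_closed (@algint L).
Proof.
split=> [|x y /algintP Ix /algintP Iy|x y /algintP Ix /algintP Iy].
- by apply/algintP; apply: integral1.
- by apply/algintP; apply: integral_sub.
by apply/algintP; apply: integral_mul.
Qed.

HB.instance Definition _ :=
  GRing.isSubringClosed.Build L (@algint L) algint_subring.

Lemma algint_root (p : {poly int}) x :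
  p \is monic -> root (map_poly intr p) x -> x \in algint.
Proof. by move=> p_mon px0; apply/algintP; exists p. Qed.

End AlgInt.

Lemma algint_ratr (L : numFieldType) (c : rat) :
  (ratr c : L) \in algint -> exists z : int, c = z%:~R.
Proof.
move/algintP=> [p p_mon pc0].
have: (ratr c : algC) \in Aint.
  apply: (@root_monic_Aint (map_poly intr p)).
  - move: pc0; rewrite -!(eq_map_poly (fun z => ratr_int _ z)).
    rewrite !map_poly_comp /=; by rewrite !fmorph_root.
  - by rewrite monic_map.
  by apply/polyOverP=> i; rewrite coef_map /= intr_int.
move/(Cint_rat_Aint (Crat_rat c))/intrP => [z cz]; exists z.
by apply: (fmorph_inj (ratr : rat -> algC)); rewrite /= cz ratr_int.
Qed.

(** * Polynomials commuting with a monic integral polynomial *)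

Section IterPoly.

Variable R : comNzRingType.
Implicit Types f : {poly R}.

Lemma horner_iter_poly f k x : (iter_poly f k).[x] = iter k (horner f) x.
Proof. by elim: k => [|k IHk]; rewrite ?hornerX //= horner_comp IHk. Qed.

Lemma map_iter_poly (S : nzRingType) (phi : {rmorphism R -> S}) f k :
  map_poly phi (iter_poly f k) = iter_poly (map_poly phi f) k.
Proof. by elim: k => [|k IHk]; rewrite ?map_polyX //= map_comp_poly IHk. Qed.

Lemma polyOver_iter_poly (S : subringClosed R) f k :
  f \is a polyOver S -> iter_poly f k \is a polyOver S.
Proof.
by move=> f_S; elim: k => [|k IHk]; rewrite ?polyOverX //= polyOver_comp.
Qed.

End IterPoly.

Lemma size_iter_poly (R : idomainType) (f : {poly R}) k :
  (size (iter_poly f k)).-1 = ((size f).-1 ^ k)%N.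
Proof.
elim: k => [|k IHk]; first by rewrite size_polyX.
by rewrite /= size_comp_poly IHk expnS.
Qed.

Lemma monic_iter_poly (R : idomainType) (f : {poly R}) k :
  f \is monic -> (1 < size f)%N -> iter_poly f k \is monic.
Proof.
move=> f_mon f_gt1; elim: k => [|k IHk]; first exact: monicX.
have it_gt1: (1 < size (iter_poly f k))%N.
  have := size_iter_poly f k; rewrite -(prednK (ltnW f_gt1)) /=.
  case: (size _) => [|[|m]] //= /esym/eqP; rewrite expn_eq0;
  by case: (size f) f_gt1 => [|[]].
by rewrite monicE lead_coef_comp // (monicP f_mon) (monicP IHk) mul1r expr1n.
Qed.

Section Commuting.

Variable L : numClosedFieldType.
Implicit Types (F : {poly int}) (g : {poly L}).

Local Notation intL := (map_poly (intr : int -> L)).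

Lemma size_intL F : size (intL F) = size F.
Proof. by rewrite size_map_inj_poly //; apply: intr_inj. Qed.

(** Two iterates of [F] of different orders agree at a point with finite orbit,
    and their difference is, up to sign, a monic integral polynomial because
    their degrees differ. *)
Lemma algint_finite_orbit F (rs : seq L) x :
  F \is monic -> (2 < size F)%N ->
  (forall k, iter k (horner (intL F)) x \in rs) -> x \in algint.
Proof.
move=> F_mon F_gt2 orb_rs.
have /(uniqPn 0)[i [j [lt_ij j_lt eq_ij]]]:
    ~~ uniq (mkseq (fun k => iter k (horner (intL F)) x) (size rs).+1).
  apply/negP=> /uniq_leq_size le_rs.
  have /le_rs: {subset mkseq (fun k => iter k (horner (intL F)) x) (size rs).+1
                <= rs} by move=> _ /mapP[k _ ->]; apply: orb_rs.
  by rewrite size_mkseq ltnn.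
rewrite size_mkseq in j_lt.
move: eq_ij; rewrite !nth_mkseq ?(ltn_trans lt_ij) // => eq_ij.
have sz_lt: (size (iter_poly F i) < size (iter_poly F j))%N.
  have d_gt1: (1 < (size F).-1)%N by rewrite -ltnS (ltn_predK F_gt2).
  apply: leq_ltn_trans (leqSpred _) _.
  by rewrite -ltn_predRL !size_iter_poly ltn_exp2l.
apply: (algint_root (p := iter_poly F j - iter_poly F i)).
  rewrite monicE lead_coefDl ?size_polyN // -monicE monic_iter_poly //.
  exact: ltnW.
rewrite /root rmorphB hornerD hornerN /= !map_iter_poly !horner_iter_poly.
by rewrite eq_ij subrr.
Qed.

(** The leading coefficient [c] of [g] is a root of unity, by comparison of
    leading coefficients in the commutation relation.  If [b] is a fixed point
    of [F], commutation makes the finite fibre [g^-1(b)] stable under [F], so its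
    points are algebraic integers; hence so are the coefficients of
    [g - b = c * \prod (X - r)], with [r] ranging over that fibre. *)
Lemma algint_commuting F g :
  F \is monic -> (2 < size F)%N -> (1 < size g)%N ->
  g \Po intL F = intL F \Po g -> g \is a polyOver algint.
Proof.
move=> F_mon F_gt2 g_gt1 gF.
have FL_mon: intL F \is monic by rewrite monic_map.
have c_neq0: lead_coef g != 0 by rewrite lead_coef_eq0 -size_poly_gt0 ltnW.
have c_int: lead_coef g \in algint.
  have := congr1 (fun p => lead_coef p) gF.
  rewrite !lead_coef_comp ?size_intL ?(ltnW F_gt2) // (monicP FL_mon).
  rewrite expr1n mulr1 mul1r; case: (size F) F_gt2 => [|[|[|d]]] //= _.
  rewrite exprS -[LHS]mulr1 => /(mulfI c_neq0) c1.
  apply: (@algint_root _ ('X^(d.+1) - 1%:P)); first exact: monicXnsubC.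
  by rewrite rmorphB /= map_polyXn map_polyC rmorph1 /root !hornerE -c1 subrr.
have sz_FX: size (F - 'X) = size F.
  by rewrite size_polyDl ?size_polyN ?size_polyX.
have /closed_rootP[b bF]: size (intL (F - 'X)) != 1.
  by rewrite size_intL sz_FX gtn_eqF // ltnW.
have b_int: b \in algint.
  apply: algint_root bF.
  by rewrite monicE lead_coefDl ?size_polyN ?size_polyX // -monicE.
have Fb: (intL F).[b] = b.
  by apply/eqP; move: bF; rewrite rmorphB /= map_polyX /root !hornerE subr_eq0.
have lc_gb: lead_coef (g - b%:P) = lead_coef g.
  by rewrite lead_coefDl // size_polyN (leq_ltn_trans (size_polyC_leq1 b)).
have [rs g_rs] := closed_field_poly_normal (g - b%:P).
rewrite lc_gb in g_rs.
have fibre x : (x \in rs) = (g.[x] == b).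
  have := congr1 (fun p => root p x) g_rs.
  by rewrite rootZ // root_prod_XsubC /root !hornerE subr_eq0 => ->.
rewrite -(subrK b%:P g) g_rs rpredD ?polyOverC // polyOverZ //.
rewrite big_seq; apply: rpred_prod => x x_rs; rewrite polyOverXsubC.
apply: (algint_finite_orbit (rs := rs) F_mon F_gt2).
elim=> [|k IHk] //=; rewrite fibre -horner_comp gF horner_comp.
by move: IHk; rewrite fibre => /eqP->; rewrite Fb.
Qed.

End Commuting.

(** * Divisibility by a primitive polynomial *)

Section MapMpoly.

Variables (n : nat) (R S : nzRingType) (phi : {rmorphism R -> S}).

Lemma map_mpoly_inj : injective phi -> injective (map_mpoly (n := n) phi).
Proof.
move=> phi_inj p q eq_pq; apply/mpolyP=> m; apply: phi_inj.
by rewrite -!mcoeff_map_mpoly eq_pq.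
Qed.

Lemma lift_mpoly (p : {mpoly S[n]}) :
  (forall m, exists c, p@_m = phi c) -> exists q, p = map_mpoly phi q.
Proof.
move=> /choice[c Dc]; exists (\sum_(m <- msupp p) c m *: 'X_[m]).
rewrite rmorph_sum {1}[p]mpolyE; apply: eq_bigr => m _.
by rewrite /= map_mpolyZ map_mpolyX Dc.
Qed.

End MapMpoly.

Lemma map_mpoly_map (n : nat) (R S T : nzRingType)
    (phi : {rmorphism R -> S}) (psi : {rmorphism S -> T})
    (chi : {rmorphism R -> T}) (p : {mpoly R[n]}) :
  (forall c, psi (phi c) = chi c) ->
  map_mpoly psi (map_mpoly phi p) = map_mpoly chi p.
Proof. by move=> Dchi; apply/mpolyP=> m; rewrite !mcoeff_map_mpoly /= Dchi. Qed.

Lemma mpoly_mulrIn (n : nat) (R : numDomainType) (p q : {mpoly R[n]}) d :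
  (0 < d)%N -> p *+ d = q *+ d -> p = q.
Proof.
move=> d_gt0 eq_pq; apply/mpolyP=> m; apply: (pmulrnI d_gt0).
by rewrite -!mcoeffMn eq_pq.
Qed.

Lemma mprimitive_mod (n p : nat) (P : {mpoly int[n]}) :
  prime p -> mprimitive P -> map_mpoly (intr : int -> 'F_p) P != 0.
Proof.
move=> p_pr P_prim; apply/eqP=> P0.
have: (p %| (1 : int))%Z.
  rewrite -P_prim; apply: (big_ind (fun c => (p %| c)%Z)) => //.
  - by move=> x y px py; rewrite dvdz_gcd px.
  move=> m _; rewrite (dvdz_pcharf (pchar_Fp p_pr)).
  by rewrite -(mcoeff_map_mpoly (intr : {additive int -> 'F_p})) P0 mcoeff0.
by rewrite dvdzE dvdn1; case: p p_pr {P0} => [|[]].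
Qed.

(** Gauss's lemma, one prime factor of [d] at a time: modulo [p] the product
    vanishes while [P] does not, so the other factor vanishes. *)
Lemma mprimitive_dvd_natmul (n d : nat) (P S T : {mpoly int[n]}) :
  mprimitive P -> (0 < d)%N -> T * P = S *+ d -> exists U, T = U *+ d.
Proof.
move=> P_prim; elim/ltn_ind: d S T => d IHd S T d_gt0 eq_TP.
have [d_gt1|d_le1] := ltnP 1 d; last first.
  by exists T; rewrite (_ : d = 1%N) //; apply/eqP; rewrite eqn_leq d_le1.
have p_pr : prime (pdiv d) by apply: pdiv_prime.
set p := pdiv d in p_pr; have p_gt0 := prime_gt0 p_pr.
pose e := (d %/ p)%N; have De : d = (e * p)%N by rewrite divnK ?pdiv_dvd.
have e_gt0 : (0 < e)%N by rewrite De muln_gt0 in d_gt0; case/andP: d_gt0.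
have [T1 DT] : exists T1, T = T1 *+ p.
  have: map_mpoly (intr : {rmorphism int -> 'F_p}) T = 0.
    apply: (mulIf (mprimitive_mod p_pr P_prim)); rewrite mul0r -rmorphM eq_TP.
    apply/mpolyP=> m; rewrite mcoeff_map_mpoly mcoeffMn mcoeff0 De mulrnA.
    by rewrite /= rmorphMn /= -mulr_natr pchar_Fp_0 ?mulr0.
  move/mpolyP=> Tp0.
  have /choice[c Dc] : forall m, exists c : int, T@_m = c *+ p.
    move=> m; have := Tp0 m; rewrite mcoeff_map_mpoly mcoeff0 => /eqP.
    rewrite -(dvdz_pcharf (pchar_Fp p_pr)) => /dvdzP[c ->]; exists c.
    by rewrite -mulr_natr natz.
  exists (\sum_(m <- msupp T) c m *: 'X_[m]).
  rewrite -sumrMnl {1}[T]mpolyE; apply: eq_bigr => m _.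
  by rewrite Dc scalerMnl.
have e_lt: (e < d)%N by rewrite De ltn_Pmulr // prime_gt1.
have [|U DU] := IHd e e_lt S T1 e_gt0.
  by apply: (mpoly_mulrIn p_gt0); rewrite -mulrnAl -DT eq_TP De mulrnA.
by exists U; rewrite DT DU -mulrnA -De.
Qed.

(** The leading coefficient of the quotient is the quotient of the leading
    coefficients, hence lies in the subfield; subtract and repeat. *)
Lemma quotient_mpoly_subfield (F L : fieldType) (phi : {rmorphism F -> L})
    (n : nat) (P S : {mpoly F[n]}) (T : {mpoly L[n]}) :
  P != 0 -> T * map_mpoly phi P = map_mpoly phi S ->
  exists U, T = map_mpoly phi U.
Proof.
move=> P_neq0; elim/mleadrect: T S => T IHT S eq_TP.
have [->|T_neq0] := eqVneq T 0; first by exists 0; rewrite rmorph0.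
have phiP_lead : mlead (map_mpoly phi P) = mlead P.
  exact: (perm_big _ (msupp_map_mpoly P (fmorph_inj phi))).
have lP_neq0 : phi (mleadc P) != 0 by rewrite fmorph_eq0 mleadc_eq0.
pose c := S@_(mlead T + mlead P)%MM / mleadc P.
have DTc : mleadc T = phi c.
  apply: (mulIf lP_neq0); rewrite -rmorphM divfK ?mleadc_eq0 //.
  rewrite -!(mcoeff_map_mpoly phi) -eq_TP.
  by rewrite -phiP_lead mleadcM.
pose T1 := T - mleadc T *: 'X_[mlead T].
have DT : T = T1 + map_mpoly phi (c *: 'X_[mlead T]).
  by rewrite map_mpolyZ map_mpolyX -DTc subrK.
have [T1_0|T1_neq0] := eqVneq T1 0.
  by rewrite DT T1_0 add0r; exists (c *: 'X_[mlead T]).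
have [|U DU] := IHT T1 (ltm_mleadD T_neq0 T1_neq0) (S - c *: 'X_[mlead T] * P).
  rewrite rmorphB rmorphM /= -eq_TP.
  by rewrite -mulrBl; congr (_ * _); apply/eqP; rewrite eq_sym subr_eq -DT.
by exists (U + c *: 'X_[mlead T]); rewrite rmorphD /= -DU.
Qed.

Lemma common_denominator (s : seq rat) :
  exists2 d, (0 < d)%N & {in s, forall c, exists z : int, c *+ d = z%:~R}.
Proof.
elim: s => [|c s [d d_gt0 Dd]]; first by exists 1%N.
exists (d * `|denq c|)%N => [|b].
  by rewrite muln_gt0 d_gt0 absz_gt0 denq_neq0.
rewrite inE => /predU1P[->|/Dd[z Dz]]; last first.
  by exists (z *+ `|denq c|); rewrite mulrnA Dz rmorphMn.
exists (numq c *+ d).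
by rewrite mulnC mulrnA rmorphMn /= numqE -[in RHS]absz_denq -pmulrn mulr_natr.
Qed.

(** The quotient [T] has rational coefficients because [P] and [S] do; clearing
    a common denominator [d] turns the equation into [T' * P = d * S] over the
    integers, and Gauss's lemma divides [T'] by [d]. *)
Lemma mprimitive_dvd (L : numFieldType) (n : nat) (P S : {mpoly int[n]})
    (T : {mpoly L[n]}) :
  mprimitive P -> map_mpoly intr S = T * map_mpoly intr P -> mdivides P S.
Proof.
move=> P_prim eq_S.
have P_neq0 : P != 0.
  by apply/eqP=> P0; move: P_prim; rewrite P0 /mprimitive msupp0 big_nil.
pose PQ := map_mpoly (intr : {rmorphism int -> rat}) P.
pose SQ := map_mpoly (intr : {rmorphism int -> rat}) S.
have QL_comp (p : {mpoly int[n]}) :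
    map_mpoly (ratr : rat -> L) (map_mpoly intr p) = map_mpoly intr p.
  by apply: map_mpoly_map => c; apply: ratr_int.
have intQ_inj := @map_mpoly_inj n _ _ (intr : {rmorphism int -> rat}) intr_inj.
have [||TQ DT] :=
    @quotient_mpoly_subfield _ L (ratr : {rmorphism rat -> L}) n PQ SQ T.
- by rewrite -(inj_eq intQ_inj) rmorph0 in P_neq0.
- by rewrite !QL_comp eq_S.
have eq_SQ : SQ = TQ * PQ.
  apply: (map_mpoly_inj (fmorph_inj (ratr : {rmorphism rat -> L}))).
  by rewrite rmorphM /= -DT !QL_comp.
have [d d_gt0 Dd] := common_denominator [seq TQ@_m | m <- msupp TQ].
have [TZ DTZ] :
    exists TZ, TQ *+ d = map_mpoly (intr : {rmorphism int -> rat}) TZ.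
  apply: lift_mpoly => m; rewrite mcoeffMn.
  have [m_T|m_T] := boolP (m \in msupp TQ); first by apply: Dd; apply: map_f.
  by exists 0; rewrite memN_msupp_eq0 ?mul0rn.
have [|U DU] := @mprimitive_dvd_natmul n d P S TZ P_prim d_gt0.
  by apply: intQ_inj; rewrite rmorphM /= -DTZ mulrnAl -eq_SQ rmorphMn.
exists U; apply: (mpoly_mulrIn d_gt0).
apply: intQ_inj; rewrite -mulrnAl -DU rmorphMn rmorphM /= -DTZ.
by rewrite mulrnAl -eq_SQ.
Qed.

(** * Conjugates of special factors *)

Lemma map_horner_alg (K L : fieldType) (phi : {rmorphism K -> L}) (n : nat)
    (i : 'I_n) (p : {poly K}) :
  map_mpoly phi (horner_alg 'X_i p) = horner_alg 'X_i (map_poly phi p).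
Proof.
rewrite /horner_alg /horner_morph /= -horner_map /= map_mpolyX.
congr _.[_]; rewrite -!map_poly_comp; apply: eq_map_poly => c /=.
by rewrite map_mpolyZ rmorph1.
Qed.

Lemma mpolyOver_horner_alg (R : comNzRingType) (S : subringClosed R) (n : nat)
    (i : 'I_n) (p : {poly R}) :
  p \is a polyOver S -> horner_alg 'X_i p \is a mpolyOver n S.
Proof.
move=> /polyOverP p_S; rewrite /horner_alg /horner_morph.
apply: rpred_horner; last exact: mpolyOverX.
apply/polyOverP=> k; rewrite coef_map /= -mul_mpolyC mulr1.
by rewrite mpolyOverC.
Qed.

(** Minimality is asked for the image of [g], since it is a statement about all
    polynomials over [L]; the remaining data live over [K], where another
    embedding can be applied to them. *)
Definition special_factor_over (K L : fieldType) (iota : {rmorphism K -> L})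
    (f : {poly int}) (n : nat) (F : {mpoly K[n]}) : Prop :=
  exists (g h : {poly K}) (a b : nat) (i j : 'I_n),
    [/\ minimal_commuting (map_poly intr f) (map_poly iota g), linear_poly h,
        commutes_with_iterate (map_poly intr f) h
      & F = horner_alg 'X_i (iter_poly g a)
            - horner_alg 'X_j (h \Po iter_poly g b)].

Lemma commutes_with_iterate_map (K L : fieldType) (iota : {rmorphism K -> L})
    (f : {poly int}) (g : {poly K}) :
  commutes_with_iterate (map_poly intr f) (map_poly iota g) <->
  commutes_with_iterate (map_poly intr f) g.
Proof.
have intr_comp k : iter_poly (map_poly intr f) k
    = map_poly iota (iter_poly (map_poly intr f) k) :> {poly L}.
  rewrite map_iter_poly -map_poly_comp; congr (iter_poly _ k).
  by apply: eq_map_poly => c /=; rewrite rmorph_int.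
split=> -[k k_gt0 eq_g]; exists k => //; move: eq_g.
  by rewrite intr_comp -!map_comp_poly => /map_poly_inj.
by rewrite intr_comp -!map_comp_poly => ->.
Qed.

(** The defining conditions only involve the degrees of [g] and [h] and their
    commutation with an iterate of [f], whose coefficients are fixed by every
    embedding: any two embeddings of [K] give special factors simultaneously. *)
Lemma special_factor_conj (K L : fieldType) (iota iota' : {rmorphism K -> L})
    (f : {poly int}) (n : nat) (F : {mpoly K[n]}) :
  special_factor_over iota f F ->
  special_factor (map_poly intr f) (map_mpoly iota' F).
Proof.
case=> g [h [a [b [i [j [[g_gt2 g_comm g_min] h_lin h_comm ->]]]]]].
exists (map_poly iota' g), (map_poly iota' h), a, b, i, j; split.
- move: g_gt2 g_min; rewrite /nonlinear size_map_poly => g_gt2 g_min.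
  split; rewrite /nonlinear ?size_map_poly //.
  by apply/commutes_with_iterate_map/(commutes_with_iterate_map iota).
- by rewrite /linear_poly size_map_poly.
- by apply/commutes_with_iterate_map.
by rewrite rmorphB /= !map_horner_alg map_comp_poly !map_iter_poly.
Qed.

Section Integrality.

Variables (L : numClosedFieldType) (f : {poly int}).
Hypotheses (f_monic : f \is monic) (f_nonlinear : nonlinear f).

Local Notation fL := (map_poly (intr : int -> L) f).

Lemma algint_commutes_with_iterate (g : {poly L}) :
  (1 < size g)%N -> commutes_with_iterate fL g -> g \is a polyOver algint.
Proof.
move=> g_gt1 [k k_gt0 eq_g].
apply: (algint_commuting (F := iter_poly f k)) => //.
- by rewrite monic_iter_poly // ltnW.
- have := size_iter_poly f k; move: f_nonlinear; rewrite /nonlinear.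
  case: (size f) => [|[|[|d]]] //= _ sz_fk.
  have: (1 < (size (iter_poly f k)).-1)%N.
    by rewrite sz_fk -(exp1n k) ltn_exp2r.
  by rewrite ltn_predRL.
by rewrite map_iter_poly.
Qed.

Lemma algint_special_factor (n : nat) (F : {mpoly L[n]}) :
  special_factor fL F -> F \is a mpolyOver n algint.
Proof.
case=> g [h [a [b [i [j [[g_gt2 g_comm _] h_lin h_comm ->]]]]]].
have g_int : g \is a polyOver algint.
  by apply: algint_commutes_with_iterate => //; apply: ltnW.
have h_int : h \is a polyOver algint.
  by apply: algint_commutes_with_iterate => //; rewrite h_lin.
rewrite rpredB // mpolyOver_horner_alg ?polyOver_comp //;
  exact: polyOver_iter_poly.
Qed.

Lemma lift_poly (K : fieldType) (iota : {rmorphism K -> L}) (g : {poly L}) :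
  {in (g : seq L), forall x, exists y, iota y = x} ->
  exists g', g = map_poly iota g'.
Proof.
move=> /lift_seq[s Ds]; exists (Poly s); apply/polyP=> i.
rewrite coef_map coef_Poly -Ds.
have [i_lt|i_ge] := ltnP i (size s); first by rewrite (nth_map 0).
by rewrite !nth_default ?size_map /= ?rmorph0.
Qed.

(** A finite list of algebraic integers controls a whole product of special
    factors: every field that contains them is a field of definition. *)
Lemma special_factors_definition (n : nat) (s : seq {mpoly L[n]}) :
  (forall F, F \in s -> special_factor fL F) ->
  exists2 t : seq L, {in t, forall x, integralOver (intr : int -> L) x}
  & forall (K : fieldType) (iota : {rmorphism K -> L}),
    {in t, forall x, exists y, iota y = x} ->
    exists2 s' : seq {mpoly K[n]}, s = map (map_mpoly iota) s'
      & forall F, F \in s' -> special_factor_over iota f F.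
Proof.
elim: s => [|F s IHs] s_spec; first by exists [::] => // K iota _; exists [::].
have [|t t_int t_def] := IHs.
  by move=> G G_s; apply: s_spec; rewrite inE G_s orbT.
have [g [h [a [b [i [j [g_min h_lin h_comm DF]]]]]]] := s_spec F (mem_head _ _).
have [g_gt2 g_comm _] := g_min.
exists ((g : seq L) ++ (h : seq L) ++ t) => [x|K iota].
  rewrite !mem_cat => /or3P[|| /t_int//].
    move: x; apply/integral_poly => k; apply/algintP; move: k; apply/polyOverP.
    by apply: algint_commutes_with_iterate => //; apply: ltnW.
  move: x; apply/integral_poly => k; apply/algintP; move: k; apply/polyOverP.
  by apply: algint_commutes_with_iterate => //; rewrite h_lin.
move=> t_lift.
have [|g' Dg] := @lift_poly K iota g.
  by move=> x x_g; apply: t_lift; rewrite mem_cat x_g.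
have [|h' Dh] := @lift_poly K iota h.
  by move=> x x_h; apply: t_lift; rewrite !mem_cat x_h orbT.
have [|s' Ds s'_spec] := t_def K iota.
  by move=> x x_t; apply: t_lift; rewrite !mem_cat x_t !orbT.
pose F' : {mpoly K[n]} := horner_alg 'X_i (iter_poly g' a)
  - horner_alg 'X_j (h' \Po iter_poly g' b).
exists (F' :: s') => [|G].
  rewrite /= -Ds DF Dg Dh rmorphB /= !map_horner_alg.
  by rewrite map_comp_poly !map_iter_poly.
rewrite inE => /predU1P[->|/s'_spec//].
exists g', h', a, b, i, j; split=> //; first by rewrite -Dg.
  by move: h_lin; rewrite Dh /linear_poly size_map_poly.
by apply/(commutes_with_iterate_map iota); rewrite -Dh.
Qed.

End Integrality.

(** * Galois norms *)

Lemma galois_rat (K : splittingFieldType rat) : galois 1 {:K}.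
Proof.
apply/and3P; split; [exact: sub1v | | exact: normalFieldf].
apply/separableP=> x _; apply/idPn=> /separablePn_pchar[p p_char _].
have : p \in [pchar rat].
  rewrite !inE in p_char *; case/andP: p_char => -> /=.
  by rewrite -(fmorph_eq0 (in_alg K)) rmorph_nat.
by rewrite pchar_num.
Qed.

Lemma Galois_norm_rat (K : splittingFieldType rat) (n : nat)
    (p : {mpoly K[n]}) :
  exists q : {mpoly rat[n]},
    \prod_(sigma in 'Gal({:K} / 1)%g) map_mpoly sigma p
      = map_mpoly (in_alg K) q.
Proof.
apply: lift_mpoly => m; set N := \prod_(_ in _) _.
suffices /vlineP[c Nm]: N@_m \in 1%VS by exists c.
have /galois_fixedField <- := galois_rat K.
apply/fixedFieldP=> [|tau Gtau]; first exact: memvf.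
rewrite -(mcoeff_map_mpoly tau); congr (_@_m).
rewrite {2}/N (reindex_acts 'R _ Gtau) ?astabsR //= rmorph_prod.
apply: eq_bigr => sigma _; apply/mpolyP=> k.
by rewrite !mcoeff_map_mpoly /= galM ?memvf.
Qed.

(** The integral multiple of [P] is the Galois norm of [Q], taken in a number
    field [K] over which all the factors of [Q] are defined. *)
Lemma special_multiple_int (L : numClosedFieldType) (n : nat) (f : {poly int})
    (P : {mpoly int[n]}) (Q : {mpoly L[n]}) :
  f \is monic -> nonlinear f -> mprimitive P ->
  special_product (map_poly intr f) Q ->
  mdivides (map_mpoly intr P) Q ->
  exists S : {mpoly int[n]},
    [/\ special_product (map_poly intr f : {poly L})
          (map_mpoly intr S : {mpoly L[n]}),
        mdivides P S
      & Q != 0 -> S != 0].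
Proof.
move=> f_mon f_nl P_prim [s s_spec DQ] [T DT].
(* A vanishing special product is itself an integral special product. *)
have [Q0|Q_neq0] := eqVneq Q 0.
  exists 0; split=> //; first by exists s; rewrite // rmorph0 -DQ Q0.
  by exists 0; rewrite mul0r.
have [t t_int t_def] := special_factors_definition f_mon f_nl s_spec.
have [K [iota t_iota]] := Galois_number_field t_int.
have [s' Ds s'_spec] := t_def K iota t_iota.
pose Q' : {mpoly K[n]} := \prod_(F <- s') F.
pose N : {mpoly K[n]} := \prod_(sigma in 'Gal({:K} / 1)%g) map_mpoly sigma Q'.
pose conj_s := [seq map_mpoly (iota \o sigma) F
  | sigma : gal_of {:K} <- enum 'Gal({:K} / 1)%g, F <- s'].
have iotaQ' : map_mpoly iota Q' = Q.
  by rewrite DQ Ds big_map rmorph_prod.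
have conj_spec F : F \in conj_s -> special_factor (map_poly intr f) F.
  case/allpairsP=> -[sigma F'] [_ /= F'_s' ->].
  by apply: (special_factor_conj (iota := iota)); apply: s'_spec.
have iotaN : map_mpoly iota N = \prod_(F <- conj_s) F.
  rewrite big_allpairs_dep big_enum rmorph_prod; apply: eq_bigr => sigma _.
  rewrite /Q' !rmorph_prod; apply: eq_bigr => F _ /=.
  exact: map_mpoly_map.
have [q DN] := Galois_norm_rat Q'.
have [S DS] : exists S : {mpoly int[n]}, map_mpoly intr S = map_mpoly iota N.
  have N_int : map_mpoly iota N \is a mpolyOver n algint.
    rewrite iotaN big_seq rpred_prod // => F F_conj.
    by apply: (algint_special_factor f_mon f_nl); apply: conj_spec.
  have [m|S DS] :=
      @lift_mpoly n _ _ (intr : {rmorphism int -> L}) (map_mpoly iota N).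
    have /mpolyOverP/(_ m) := N_int.
    rewrite mcoeff_map_mpoly /N DN mcoeff_map_mpoly /= alg_num_field fmorph_rat.
    by case/algint_ratr=> z ->; exists z; rewrite ratr_int.
  by exists S.
exists S; split.
- by exists conj_s; rewrite ?DS.
- pose N1 := \prod_(sigma in 'Gal({:K} / 1)%g | sigma != 1%g) map_mpoly sigma Q'.
  apply: (mprimitive_dvd (T := T * map_mpoly iota N1)) => //.
  (* The factor of the identity automorphism is [Q], a multiple of [P]. *)
  rewrite DS /N (bigD1 1%g) ?group1 //= rmorphM /=.
  rewrite [map_mpoly (gal_repr _) Q'](_ : _ = Q') ?iotaQ' ?DT; last first.
    by apply/mpolyP=> m; rewrite mcoeff_map_mpoly /= gal_id.
  by rewrite mulrAC.
move=> _; apply/eqP=> S0; move/eqP: DS; rewrite S0 rmorph0 eq_sym.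
have Q'_neq0 : Q' != 0.
  by apply: contraNneq Q_neq0 => Q'0; rewrite -iotaQ' Q'0 rmorph0.
rewrite -(rmorph0 (map_mpoly iota)) (inj_eq (map_mpoly_inj (fmorph_inj iota))).
apply/negP/prodf_neq0 => sigma _.
rewrite -(rmorph0 (map_mpoly sigma)).
by rewrite (inj_eq (map_mpoly_inj (fmorph_inj sigma))).
Qed.

Theorem theorem7p9 (R : realType) (n : nat) (f : {poly int})
    (P : {mpoly int[n]}) (Q : {mpoly R[i][n]}) :
  f \is monic -> nonlinear f -> mprimitive P ->
  special_product (map_poly intr f) Q ->
  mdivides (map_mpoly intr P) Q ->
  exists S : {mpoly int[n]},
    [/\ special_product (map_poly intr f : {poly R[i]})
          (map_mpoly intr S : {mpoly R[i][n]}),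
        mdivides P S
      & Q != 0 -> S != 0].
Proof. exact: special_multiple_int. Qed.
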